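(* Let $k\ge 2$ be a fixed integer and let $n_1,\ldots,n_k$ be positive integers with $n_k=\min_{1\le i\le k} n_i$. Let $G\sim\mathcal{T}(n_1,\ldots,n_k)$. Then, with probability $1-o(1)$ as $n_k\to\infty$, it holds that $f_k(G)=s(G)-k+1$.
   Context: $\mathcal{T}(n_1,\ldots,n_k)$ denotes the probability space of $k$-partite tournaments obtained from the complete $k$-partite graph with vertex classes $V_1,\ldots,V_k$, $|V_i|=n_i$, by orienting each edge independently and uniformly at random. For a $k$-partite tournament $G$, $s(G)$ denotes the size of its smallest vertex class (so $s(G)=n_k$ here). A feedback arc set of a directed graph $G$ is a set of edges meeting every directed cycle of $G$ (viewed as a spanning subgraph of $G$). For an oriented graph $G$, $f_k(G)$ is the maximum integer $t$ such that every feedback arc set of $G$ contains $t$ pairwise vertex-disjoint copies of the transitive tournament on $k$ vertices (i.e. of an acyclic $k$-clique). *)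

(* Defs.v *)
From HB Require Import structures.
From mathcomp Require Import all_boot all_order all_algebra.
From mathcomp Require Import boolp.
Set Implicit Arguments. Unset Strict Implicit. Unset Printing Implicit Defensive.
Import Order.TTheory GRing.Theory Num.Theory.

(* Vertex set of the complete k-partite graph with classes V_i = {i} x 'I_(n i),
   i < k.  The class of a vertex v is [tag v]. *)
Notation vtx k n := {i : 'I_k & 'I_(n i)}.

Definition is_orientation (k : nat) (n : nat -> nat)
  (A : {ffun vtx k n * vtx k n -> bool}) : bool :=
  [forall u, forall v,
     (A (u, v) ==> (tag u != tag v)) &&
     ((tag u != tag v) ==> (A (u, v) != A (v, u)))].

Definition orientations (k : nat) (n : nat -> nat) :
  {set {ffun vtx k n * vtx k n -> bool}} := [set A | is_orientation A].

Definition prob_T (k : nat) (n : nat -> nat)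
  (P : {ffun vtx k n * vtx k n -> bool} -> Prop) : rat :=
  (#|[set A in orientations k n | `[< P A >]]|%:R
     / #|orientations k n|%:R)%R.

Definition cycle_arcs (V : finType) (c : seq V) : seq (V * V) :=
  zip c (rot 1 c).

Definition directed_cycle (V : finType) (arc : rel V) (c : seq V) : Prop :=
  [/\ c != [::], uniq c & cycle arc c].

Definition feedback_arc_set (V : finType) (arc : rel V) (F : {set V * V}) : Prop :=
  (forall p, p \in F -> arc p.1 p.2) /\
  (forall c, directed_cycle arc c -> has (fun p => p \in F) (cycle_arcs c)).

(* F (viewed as a spanning subdigraph) contains t pairwise vertex-disjoint
   copies of the transitive tournament TT_k: embeddings g a : 'I_k -> V
   (a < t), jointly injective, such that i < j gives an arc g a i -> g a j
   of F. *)
Definition has_disjoint_TT (V : finType) (k t : nat) (F : {set V * V}) : Prop :=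
  exists g : 'I_t -> 'I_k -> V,
    (forall a i b j, g a i = g b j -> a = b /\ i = j) /\
    (forall a (i j : 'I_k), (i < j)%N -> (g a i, g a j) \in F).

Definition fk_prop (V : finType) (arc : rel V) (k t : nat) : Prop :=
  forall F : {set V * V}, feedback_arc_set arc F -> has_disjoint_TT k t F.

Definition fk_is (V : finType) (arc : rel V) (k m : nat) : Prop :=
  fk_prop arc k m /\ (forall t, fk_prop arc k t -> (t <= m)%N).

(* Main.v *)
(* A feedback arc set contains all forward arcs of some linear order, and conversely.
   Upper bound: choose k - 1 vertices s_i of the smallest class, and discard from G
   all arcs between s_i and V_i; a star forest is acyclic, so the remaining arcs
   form a feedback arc set, in which no k-clique meets any s_i.
   Lower bound: keep m = n_k vertices of each class. With high probability, for
   every linear order, the graph of forward arcs satisfies: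
   - for i <> j, at most one vertex of V_i has small degree to V_j, because any
     two x, x' in V_i have linearly many y in V_j with x -> y -> x';
   - "spread": given linearly many disjoint tuples, all but few vertices of V_i
     complete linearly many of them.  For a fixed order the forward graph has
     independent fair bits, so the failure probability exp(-c m^2) beats the
     m^(O(m)) choices of orders, tuples and vertices.
   Discard k - 1 vertices per class so that all degrees are linear.  The perfect
   tiling of the rest is found by absorption: fix a reservoir of disjoint cliques,
   cover greedily the vertices that complete few reservoir cliques, tile greedily
   what is left, and switch the last vertices into the reservoir. *)
Require Import Defs.
From HB Require Import structures.
From mathcomp Require Import all_boot all_order all_algebra.
From mathcomp Require Import boolp.
From mathcomp Require Import zify.
Import Order.TTheory GRing.Theory Num.Theory.

(** * Arithmetic of the parameters *)

(** With [r = 2 * M * e], [d = 2 * (k * r).+1] and [a = 2 * M * d], the left side is the degree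
    threshold [d1] of the final proof, and the coefficient of [e] on the right is its constant
    [K]. *)
Lemma scale_budget (k M e : nat) : 0 < e ->
  k.-1 + k * (2 * M * (2 * (k * (2 * M * e)).+1)) + k * (2 * M * e) + (k * (2 * M * e)).+1
  <= (k + k * (4 * M * (2 * k * M + 1)) + 4 * k * M + 1) * e.
Proof.
move=> e0; have h1 : k <= k * e by rewrite leq_pmulr.
have h2 : k * M <= k * M * e by rewrite leq_pmulr.
lia.
Qed.

Lemma scale_division (K m E0 : nat) : 0 < K -> 32 * K * (E0 + 1) <= m ->
  [/\ E0 < m %/ (32 * K), 32 * K * (m %/ (32 * K)) <= m &
      m <= 64 * K * (m %/ (32 * K))].
Proof.
move=> K0 Hm; have K32 : 0 < 32 * K by rewrite muln_gt0.
set e := m %/ _; have e0 : E0 < e by rewrite leq_divRL // -addn1 mulnC.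
split=> //; first by rewrite mulnC leq_divM.
have := ltn_ceil m K32; rewrite -/e => h.
have : 32 * K <= 32 * K * e by rewrite leq_pmulr // (leq_ltn_trans _ e0).
lia.
Qed.

(** This is the [e]-th power of the last hypothesis: a power of [Q] with exponent linear in [e]
    loses against an exponential in [e * s]. *)
Lemma power_budget (C Q D x e s : nat) : 0 < Q -> 0 < e -> x <= D * e -> e <= s ->
  C * Q ^ D <= 2 ^ e -> C * Q ^ x <= 2 ^ (e * s).
Proof.
move=> Q0 e0 xD es H; case: (posnP C) => [->//|C0].
apply: leq_trans (_ : (C * Q ^ D) ^ e <= _).
  rewrite expnMn -expnM leq_mul // ?leq_pexp2l //.
  by rewrite -[leqLHS]expn1 leq_pexp2l.
apply: leq_trans (_ : (2 ^ e) ^ e <= _).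
  by rewrite leq_exp2r.
by rewrite -expnM leq_exp2l // leq_mul2l es orbT.
Qed.

(** Union bound for one of three bad events: [T] parameter choices, each of probability at most
    [1 / K], together take at most a share [1 / (3 * J)] of the [O] orientations. *)
Lemma union_share (J b K T O : nat) : 0 < K ->
  b * K <= T * O -> 3 * J * T <= K -> 3 * (b * J) <= O.
Proof.
move=> K0 h1 h2; rewrite -(leq_pmul2r K0).
have := leq_mul (leqnn (3 * J)) h1; have := leq_mul h2 (leqnn O).
lia.
Qed.

Lemma ratio_ge (eps : rat) (J g b O : nat) : (0 < eps)%R -> (eps^-1 < J%:R)%R -> 0 < O ->
  O <= g + b -> b * J <= O -> (1 - eps <= g%:R / O%:R)%R.
Proof.
move=> eps0 JP O0 h1 h2; rewrite ler_pdivlMr ?ltr0n // mulrBl mul1r lerBlDr.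
have h3 : (O%:R <= g%:R + b%:R :> rat)%R by rewrite -natrD ler_nat.
apply: le_trans h3 _; rewrite lerD2l.
have h4 : (eps * (b%:R * J%:R) <= eps * O%:R)%R by rewrite ler_pM2l // -natrM ler_nat.
apply: le_trans h4; rewrite mulrCA ler_peMr ?ler0n //.
by rewrite mulrC -ler_pdivrMr // div1r ltW.
Qed.

Set Implicit Arguments. Unset Strict Implicit. Unset Printing Implicit Defensive.

(** * Tilings by absorption *)

Section Tiling.
Variables (k m : nat) (E : rel ('I_k * 'I_m)).
Hypothesis Esym : symmetric E.

Notation tile := {ffun 'I_k -> 'I_m}.

Definition clique (f : tile) : bool :=
  [forall i, forall j, (i != j) ==> E (i, f i) (j, f j)].

Lemma cliqueP (f : tile) :
  reflect (forall i j, i != j -> E (i, f i) (j, f j)) (clique f).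
Proof.
apply: (iffP forallP) => [H i j nij|H i].
  by have /forallP/(_ j)/implyP := H i; apply.
by apply/forallP => j; apply/implyP; apply: H.
Qed.

Definition tile_disjoint (T : seq tile) : Prop :=
  forall l, uniq [seq f l | f : tile <- T].

Definition upd (f : tile) (i : 'I_k) (v : 'I_m) : tile :=
  [ffun j => if j == i then v else f j].

Definition completes (i : 'I_k) (v : 'I_m) (f : tile) : bool :=
  [forall (j | j != i), E (i, v) (j, f j)].

Lemma completesP i v (f : tile) :
  reflect (forall j, j != i -> E (i, v) (j, f j)) (completes i v f).
Proof. exact: (iffP forall_inP). Qed.

Lemma clique_upd i v (f : tile) : (forall j j', j != i -> j' != i -> j != j' ->
  E (j, f j) (j', f j')) -> completes i v f -> clique (upd f i v).
Proof.
move=> Hf /completesP H; apply/cliqueP => j j' njj'; rewrite !ffunE.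
case: (eqVneq j i) => [ji|ji]; case: (eqVneq j' i) => [j'i|j'i].
- by rewrite ji j'i eqxx in njj'.
- by rewrite ji; apply: H.
- by rewrite j'i Esym; apply: H.
- exact: Hf.
Qed.

(* The i-th coordinate of the tuples q is ignored. *)
Definition spread (d a r : nat) : Prop :=
  forall (i : 'I_k) (q : 'I_a -> tile) (X : {set 'I_m}),
    (forall j, injective (fun b => q b j)) -> r <= #|X| ->
    exists2 v, v \in X & d <= #|[set b | completes i v (q b)]|.

(** Every round removes a single vertex from each class, so [c] candidates remain throughout. *)
Lemma greedy (P : tile -> Prop) (c : nat) :
  (forall X : 'I_k -> {set 'I_m}, (forall l, c <= #|X l|) ->
     exists2 f : tile, P f & forall l, f l \in X l) ->
  forall (s : nat) (X : 'I_k -> {set 'I_m}), (forall l, c + s <= #|X l|) ->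
  exists T : seq tile, [/\ size T = s, forall f, f \in T -> P f,
    forall f l, f \in T -> f l \in X l & tile_disjoint T].
Proof.
move=> H; elim=> [|s IH] X HX; first by exists [::]; split.
have [f Pf fX] : exists2 f : tile, P f & forall l, f l \in X l.
  by apply: H => l; apply: leq_trans (HX l); apply: leq_addr.
have [|T [sT PT XT uT]] := IH (fun l => X l :\ f l).
  by move=> l; have := HX l; rewrite (cardsD1 (f l) (X l)) fX addnS ltnS.
exists (f :: T); split=> [|g|g l|l] /=.
- by rewrite sT.
- by rewrite inE => /predU1P[->|/PT].
- by rewrite inE => /predU1P[->|/XT -/(_ l)] //; rewrite inE => /andP[].
- rewrite uT andbT; apply/negP => /mapP[g /XT -/(_ l) + e].
  by rewrite e !inE eqxx.
Qed.

Lemma greedy_fun (P : tile -> Prop) (c : nat) (I : finType) :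
  (forall X : 'I_k -> {set 'I_m}, (forall l, c <= #|X l|) ->
     exists2 f : tile, P f & forall l, f l \in X l) ->
  forall X : 'I_k -> {set 'I_m}, (forall l, c + #|I| <= #|X l|) ->
  exists q : I -> tile, [/\ forall b, P (q b), forall b l, q b l \in X l &
    forall l, injective (fun b => q b l)].
Proof.
move=> H X HX; have [T [sT PT XT uT]] := greedy H HX.
pose q (b : I) : tile := tnth (in_tuple T) (cast_ord (esym sT) (enum_rank b)).
have qT b : q b \in T by apply: mem_tnth.
exists q; split=> [b|b l|l b b' /= e]; [exact: PT|exact: XT|].
apply: enum_rank_inj; apply: val_inj => /=.
have := uT l => /(uniqP (q b l)) /(_ (enum_rank b) (enum_rank b')).
rewrite !inE size_map sT => /(_ (ltn_ord _) (ltn_ord _)); apply.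
have nthq (x : I) : nth (q b l) [seq f l | f : tile <- T] (enum_rank x) = q x l.
  have -> : q x = nth (q b) T (enum_rank x) by apply: tnth_nth.
  by rewrite (nth_map (q b)) // sT.
by rewrite !nthq.
Qed.

Section FindClique.
Variables (e r : nat).
Hypothesis e_gt0 : 0 < e.
Hypothesis sparse : spread e r r.

(** Induction over the classes: [r] disjoint partial cliques on the first [n] classes are taken
    greedily, and [spread] gives a vertex of the next class that completes one of them. Entries in
    later classes are fillers. *)
Lemma find_pclique (n : nat) : n <= k -> forall X : 'I_k -> {set 'I_m},
  (forall l, (n * r).+1 <= #|X l|) ->
  exists2 f : tile, (forall i j : 'I_k, i < n -> j < n -> i != j ->
    E (i, f i) (j, f j)) & forall l, f l \in X l.
Proof.
elim: n => [|n IH] nk X HX.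
  have HX' l : exists v, v \in X l by apply/set0Pn; rewrite -card_gt0 (leq_trans _ (HX l)).
  exists [ffun l => xchoose (HX' l)] => // l; rewrite ffunE; exact: xchooseP.
have [|q [qP qX qI]] := greedy_fun (I := 'I_r) (IH (ltnW nk)) (X := X).
- by move=> l; rewrite card_ord; apply: leq_trans (HX l); rewrite mulSn; lia.
pose i : 'I_k := Ordinal nk.
have [|v vX /(leq_trans e_gt0)] := @sparse i q (X i) qI.
  by apply: leq_trans (HX i); rewrite mulSn; lia.
rewrite card_gt0 => /set0Pn[b]; rewrite inE => /completesP bv.
exists (upd (q b) i v) => [j j' jn j'n njj'|l]; rewrite !ffunE; last first.
  by case: eqP => [->|_].
have small (x : 'I_k) : x < n.+1 -> x != i -> x < n.
  by rewrite ltnS leq_eqVlt -val_eqE /= => /orP[->|].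
case: (eqVneq j i) => [ji|ji]; case: (eqVneq j' i) => [j'i|j'i].
- by rewrite ji j'i eqxx in njj'.
- by rewrite ji; apply: bv.
- by rewrite j'i Esym; apply: bv.
- by apply: qP => //; apply: small.
Qed.

Lemma find_clique (X : 'I_k -> {set 'I_m}) : (forall l, (k * r).+1 <= #|X l|) ->
  exists2 f : tile, clique f & forall l, f l \in X l.
Proof.
move=> /(find_pclique (leqnn k))[f fP fX]; exists f => //.
by apply/cliqueP => i j; apply: fP.
Qed.

End FindClique.
End Tiling.

Section Absorption.
Variables (k m : nat) (E : rel ('I_k * 'I_m)).
Hypothesis Esym : symmetric E.

Notation tile := {ffun 'I_k -> 'I_m}.

Lemma upd_same (f : tile) i v : upd f i v i = v.
Proof. by rewrite ffunE eqxx. Qed.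

Lemma upd_other (f : tile) i v j : j != i -> upd f i v j = f j.
Proof. by rewrite ffunE => /negbTE->. Qed.

(** This is why an absorption step preserves disjointness: in class [j] only the tile [F j] changes,
    giving up [F j j] for [w j], and [F j j] goes to the clique of released vertices. *)
Lemma perm_upd (F : 'I_k -> tile) (w : 'I_k -> 'I_m) (j : 'I_k) :
  perm_eq (F j j :: [seq upd (F l) l (w l) j | l <- enum 'I_k])
          (rcons [seq F l j | l <- enum 'I_k] (w j)).
Proof.
have pj : perm_eq (enum 'I_k) (j :: rem j (enum 'I_k)).
  by apply: perm_to_rem; rewrite mem_enum.
rewrite perm_sym perm_rcons.
apply: perm_trans (_ : perm_eq _ (w j :: F j j :: [seq F l j | l <- rem j (enum 'I_k)])) _.
  by rewrite perm_cons; apply: (perm_map (fun l => F l j)) pj.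
apply: perm_trans (_ : perm_eq _ (F j j :: w j :: [seq F l j | l <- rem j (enum 'I_k)])) _.
  by rewrite -cat1s -(cat1s (F j j)) perm_catCA.
rewrite perm_cons perm_sym.
apply: perm_trans (perm_map (fun l => upd (F l) l (w l) j) pj) _.
rewrite /= upd_same perm_cons.
suff -> : [seq upd (F l) l (w l) j | l <- rem j (enum 'I_k)] =
          [seq F l j | l <- rem j (enum 'I_k)] by [].
apply/eq_in_map => l; rewrite mem_rem_uniq ?enum_uniq // !inE => /andP[lj _].
by rewrite upd_other // eq_sym.
Qed.

(* A pair (l, f) in the reservoir S is a clique f whose vertex of class l may be
   exchanged. One step takes leftover vertices w_l, one per class, exchanges each
   with the vertex of a clique f_l, the f_l being chosen so that the vertices
   released form a new clique. *)
Lemma absorb (c : nat) (l0 : 'I_k) :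
  (forall X : 'I_k -> {set 'I_m}, (forall l, c <= #|X l|) ->
     exists2 f : tile, clique E f & forall l, f l \in X l) ->
  forall n (S : seq ('I_k * tile)) (O : seq tile) (W : 'I_k -> seq 'I_m),
    (forall l, uniq ([seq p.2 l | p : 'I_k * tile <- S] ++
                     [seq f l | f : tile <- O] ++ W l)) ->
    (forall p, p \in S -> clique E p.2) -> (forall f, f \in O -> clique E f) ->
    (forall l, size (W l) = n) ->
    (forall l w, w \in W l ->
       c + n <= count (fun p => (p.1 == l) && completes E l w p.2) S) ->
  exists T : seq tile, [/\ size T = size S + size O + n,
    forall f, f \in T -> clique E f & tile_disjoint T].
Proof.
move=> fc; elim=> [|n IH] S O W uW cS cO sW HW.
  exists ([seq p.2 | p <- S] ++ O); split=> [|f|l].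
  - by rewrite size_cat size_map addn0.
  - by rewrite mem_cat => /orP[/mapP[p pS ->]|/cO//]; apply: cS.
  - have := uW l; rewrite (size0nil (sW l)) cats0 map_cat -map_comp.
    exact.
have Wcons l : {w & W l = w :: behead (W l)}.
  by case: (W l) (sW l) => // w s _; exists w.
pose w l := projT1 (Wcons l).
pose W' l := behead (W l).
have WE l : W l = w l :: W' l by rewrite /w; case: (Wcons l).
pose ok l := fun p : 'I_k * tile => (p.1 == l) && completes E l (w l) p.2.
(* [X l] holds the vertices that a reservoir clique of type [l] can release in exchange for [w l]; a
   clique inside these sets tells which tiles to exchange. *)
pose X l := [set x in [seq p.2 l | p : 'I_k * tile <- S & ok l p]].
have uS2 l : uniq [seq p.2 l | p : 'I_k * tile <- S].
  by have := uW l; rewrite cat_uniq => /andP[].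
have uS : uniq S by apply: map_uniq (uS2 l0).
have [l|g cg gX] := fc X.
  rewrite cardsE (card_uniqP _) ?size_map ?size_filter.
    apply: leq_trans (HW l (w l) _); first by rewrite leq_addr.
    by rewrite WE mem_head.
  by apply: subseq_uniq (uS2 l); apply/map_subseq/filter_subseq.
have [F FP] : exists F : 'I_k -> tile, forall l,
    [/\ (l, F l) \in S, completes E l (w l) (F l) & g l = F l l].
  apply: (@fin_all_exists _ _ (fun l f => [/\ (l, f) \in S, completes E l (w l) f & g l = f l])).
  move=> l; have := gX l; rewrite inE => /mapP[[l' f]] /=.
  rewrite mem_filter /ok /= => /andP[/andP[/eqP-> lf] fS] gf.
  by exists f; split.
pose s1 := [seq (l, F l) | l <- enum 'I_k].
have us1 : uniq s1 by rewrite map_inj_uniq ?enum_uniq // => l l' [].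
pose S' := [seq p <- S | p \notin s1].
have permS : perm_eq S (s1 ++ S').
  rewrite perm_sym; apply: perm_trans (_ : perm_eq _ ([seq p <- S | p \in s1] ++ S')) _.
    rewrite perm_cat2r; apply: uniq_perm => //; first exact: filter_uniq.
    move=> p; rewrite mem_filter; case ps: (p \in s1) => //=; symmetry.
    by case/mapP: ps => l _ ->; case: (FP l).
  exact: permEl (perm_filterC _ _).
pose O' := g :: [seq upd (F l) l (w l) | l <- enum 'I_k] ++ O.
have szS : size S = k + size S'.
  by rewrite (perm_size permS) size_cat size_map size_enum_ord.
have [|||||T [sT cT uT]] := IH S' O' W'.
- move=> j; rewrite -(perm_uniq (_ : perm_eq ([seq p.2 j | p : 'I_k * tile <- S] ++
    [seq f j | f : tile <- O] ++ W j) _)) //.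
  rewrite WE; apply/permP => a.
  have /permP/(_ a) := perm_map (fun p : 'I_k * tile => p.2 j) permS.
  have /permP/(_ a) := perm_upd F w j.
  have [_ _ gj] := FP j.
  have e1 : [seq p.2 j | p : 'I_k * tile <- s1] = [seq F l j | l <- enum 'I_k].
    by rewrite -map_comp.
  have e2 : [seq f j | f : tile <- O'] = F j j :: [seq upd (F l) l (w l) j | l <- enum 'I_k]
      ++ [seq f j | f : tile <- O].
    by rewrite /= map_cat gj -map_comp.
  rewrite -cats1 map_cat e1 e2 /= !count_cat /= !count_cat /=.
  lia.
- by move=> p; rewrite mem_filter => /andP[_ /cS].
- move=> f; rewrite inE mem_cat => /or3P[/eqP->//|/mapP[l _ ->]|/cO//].
  have [lS lw _] := FP l; apply: clique_upd => //.
  by move=> j j' _ _; have /cliqueP := cS _ lS; apply.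
- by move=> l; rewrite /W' size_behead sW.
- move=> l x xW; have := HW l x; rewrite WE inE xW orbT => /(_ isT).
  rewrite (permP permS) count_cat.
  (* A step uses only one pair of type [l], so the supply for class [l] drops by at most one, as [n]
     does. *)
  set a := (X in count X s1); suff : count a s1 <= 1.
    by move: (count a s1) (count a S') => u v; lia.
  rewrite count_map; apply: leq_trans (_ : count_mem l (enum 'I_k) <= 1).
    by apply: sub_count => j /= /andP[].
  by rewrite count_uniq_mem ?enum_uniq // leq_b1.
exists T; split=> //; rewrite sT szS /= size_cat size_map size_enum_ord; lia.
Qed.

End Absorption.

Lemma subset_of_card (T : finType) (A : {set T}) n : n <= #|A| ->
  exists2 B : {set T}, B \subset A & #|B| = n.
Proof.
move=> nA; exists [set x in take n (enum A)].
  by apply/subsetP => x; rewrite inE => /mem_take; rewrite mem_enum.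
rewrite cardsE (card_uniqP _) ?take_uniq ?enum_uniq // size_take_min -cardE.
exact/minn_idPl.
Qed.

(** * From spread and degree conditions to a tiling that misses [k - 1] vertices per class *)

Section PerfectTiling.
Variables (k m : nat) (E : rel ('I_k * 'I_m)).
Hypothesis Esym : symmetric E.

Notation tile := {ffun 'I_k -> 'I_m}.

Definition covered (T : seq tile) (l : 'I_k) : {set 'I_m} :=
  [set x in [seq f l | f : tile <- T]].

Lemma card_covered T l : tile_disjoint T -> #|covered T l| = size T.
Proof. by move=> uT; rewrite cardsE (card_uniqP _) ?size_map. Qed.

(** An uncovered [x] is placed on a clique found among its neighbours outside the earlier cliques;
    these occupy at most [N] vertices per class, so [c] neighbours remain. *)
Lemma cover_vertices (c N : nat) (Y : 'I_k -> {set 'I_m}) :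
  (forall X : 'I_k -> {set 'I_m}, (forall l, c <= #|X l|) ->
     exists2 f : tile, clique E f & forall l, f l \in X l) ->
  (forall l, c <= #|Y l|) ->
  (forall l x j, x \in Y l -> j != l ->
     c + N <= #|[set y in Y j | E (l, x) (j, y)]|) ->
  forall B : seq ('I_k * 'I_m), size B <= N ->
  (forall p, p \in B -> p.2 \in Y p.1) ->
  exists C : seq tile, [/\ size C <= size B, forall f, f \in C -> clique E f,
    forall f l, f \in C -> f l \in Y l, tile_disjoint C &
    forall p, p \in B -> p.2 \in covered C p.1].
Proof.
move=> fc cY degY; elim=> [|[l x] B IH] sB BY; first by exists [::]; split.
have [|p pB|C [sC cC CY uC BC]] := IH; first exact: ltnW.
  by apply: BY; rewrite inE pB orbT.
case: (boolP (x \in covered C l)) => [xC|xC].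
  exists C; split=> //= [|p]; first exact: leqW.
  by rewrite inE => /predU1P[->//|]; apply: BC.
have xY : x \in Y l by apply: (BY (l, x)); apply: mem_head.
(* The entry found in class [l] is a placeholder, overwritten by [x] below. *)
pose X j := if j == l then Y l else [set y in Y j | E (l, x) (j, y)] :\: covered C j.
have [j|f cf fX] := fc X.
  rewrite /X; case: (eqVneq j l) => // jl.
  have := degY l x j xY jl; set A := [set y in _ | _] => AN.
  rewrite cardsD; have := subset_leq_card (subsetIr A (covered C j)).
  rewrite card_covered //; move: sC sB AN => /=.
  move: #|_| #|_| (size _) (size _) => ? ? ? ?; lia.
have fXj j : j != l -> [/\ f j \in Y j, E (l, x) (j, f j) & f j \notin covered C j].
  by move=> jl; have := fX j; rewrite /X (negbTE jl) !inE => /and3P[? ? ?].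
exists (upd f l x :: C); split=> /=.
- exact: sC.
- move=> g; rewrite inE => /predU1P[->|/cC//]; apply: clique_upd => //.
    by move=> j j' _ _; have /cliqueP := cf; apply.
  by apply/completesP => j /fXj[].
- move=> g j; rewrite inE => /predU1P[->|/CY//].
  case: (eqVneq j l) => [->|jl]; first by rewrite upd_same.
  by rewrite upd_other //; case: (fXj j jl).
- move=> j /=; rewrite uC andbT.
  case: (eqVneq j l) => [->|jl]; first by rewrite upd_same; rewrite inE in xC.
  by rewrite upd_other //; case: (fXj j jl) => _ _; rewrite inE.
- move=> p; rewrite inE => /predU1P[->|/BC]; rewrite !inE /=.
    by rewrite upd_same eqxx.
  by move->; rewrite orbT.
Qed.

Lemma tiling_exists (e d d1 a r : nat) :
  1 < k -> 0 < e -> spread E e r r -> spread E d a r ->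
  (forall (i j : 'I_k) x x', i != j -> x != x' ->
     d1 <= #|[set y | E (i, x) (j, y)]| \/ d1 <= #|[set y | E (i, x') (j, y)]|) ->
  2 * (k * r).+1 <= d -> k.-1 + k * a + k * r + (k * r).+1 <= d1 -> d1 <= m ->
  exists T : seq tile, [/\ size T = m - k.-1,
    forall f, f \in T -> clique E f & tile_disjoint T].
Proof.
move=> k_gt1 e_gt0 spE spD low dc d1c d1m.
pose c := (k * r).+1.
have fc := find_clique Esym e_gt0 spE; rewrite -/c in fc.
pose t := m - k.-1.
pose deg l x j := #|[set y | E (l, x) (j, y)]|.
pose Low l := [set x | [exists (j | j != l), deg l x j < d1]].
have cLow l : #|Low l| <= k.-1.
  (* Each low vertex is sent to a class towards which its degree is low; by [low], two vertices of
     class [l] never share that class. *)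
  pose f x := if [pick j | (j != l) && (deg l x j < d1)] is Some j then j else l.
  have fP x : x \in Low l -> f x != l /\ deg l x (f x) < d1.
    rewrite inE /f => /existsP[j Hj]; case: pickP => [j' /andP[]//|/(_ j)].
    by rewrite Hj.
  have finj : {in Low l &, injective f}.
    move=> x x' /fP[xl dx] /fP[_ dx'] ff; apply/eqP/negPn/negP => xx'.
    rewrite eq_sym in xl.
    by case: (low l (f x) x x' xl xx'); rewrite leqNgt -?/(deg _ _ _) ?dx ?ff ?dx'.
  rewrite -(card_in_imset finj).
  have -> : k.-1 = #|[set~ l]| by rewrite cardsC1 card_ord.
  by apply/subset_leq_card/subsetP => _ /imsetP[x /fP[fl _] ->]; rewrite !inE.
have /fin_all_exists2[U UL cU] : forall l, exists2 B : {set 'I_m}, B \subset ~: Low l & #|B| = t.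
  move=> l; apply: subset_of_card; rewrite cardsCs setCK card_ord.
  by rewrite leq_sub2l.
have degU l x j : x \in U l -> j != l -> d1 <= deg l x j.
  move=> /(subsetP (UL l)); rewrite !inE => /existsPn/(_ j) + jl.
  by rewrite jl -leqNgt.
(* The reservoir: [a] disjoint cliques for every class [l]; those indexed by [(l, b)] may exchange
   their vertex of class [l]. *)
have [|q [cq qU qI]] := greedy_fun (I := ('I_k * 'I_a)%type) fc (X := U).
  by move=> l; rewrite cU card_prod !card_ord /t /c; lia.
pose R l := [set q p l | p in [set: 'I_k * 'I_a]].
have cR l : #|R l| = k * a by rewrite card_imset // cardsT card_prod !card_ord.
pose Y l := U l :\: R l.
have RU l : R l \subset U l by apply/subsetP => _ /imsetP[p _ ->].
have cY l : #|Y l| = t - k * a by rewrite cardsD (setIidPr (RU l)) cU cR.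
pose bad l := [set x in Y l | #|[set b | completes E l x (q (l, b))]| < d].
have cbad l : #|bad l| <= r.
  rewrite leqNgt; apply/negP => /ltnW rb.
  have [|x] := @spD l (fun b => q (l, b)) (bad l) _ rb.
    by move=> j b b' /(qI j) [].
  by rewrite inE => /andP[_ /ltn_geF ->].
pose B := [seq (l, x) | l <- enum 'I_k, x <- enum (bad l)].
have BP p : (p \in B) = (p.2 \in bad p.1).
  apply/allpairsPdep/idP => [[l [x [_ xb ->]]]|pb] /=; first by rewrite mem_enum in xb.
  by exists p.1, p.2; rewrite !mem_enum; split=> //; case: (p).
have sB : size B <= k * r.
  rewrite size_allpairs_dep sumnE big_map.
  apply: leq_trans (_ : \sum_(l <- enum 'I_k) r <= _).
    by apply: leq_sum => l _; rewrite -cardE.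
  by rewrite big_enum /= sum_nat_const card_ord.
have [||p|C [sC cC CY uC BC]] := @cover_vertices c (k * r) Y fc _ _ B sB.
- by move=> l; rewrite cY /c /t; lia.
- move=> l x j xY jl; have := degU l x j; rewrite inE in xY.
  case/andP: xY => _ -> /(_ isT jl) dx.
  (* Passing to [Y j] costs [k - 1] discarded and [k * a] reservoir vertices; what is left of [d1]
     pays for [c + k * r]. *)
  have -> : [set y in Y j | E (l, x) (j, y)] = [set y | E (l, x) (j, y)] :\: (~: U j :|: R j).
    apply/setP => y; rewrite /Y !inE negb_or negbK.
    by rewrite (andbC (y \in U j)).
  rewrite cardsD; set A := [set y | _] in dx *.
  have := subset_leq_card (subsetIr A (~: U j :|: R j)).
  have : #|~: U j :|: R j| <= k.-1 + k * a.
    rewrite cardsU cR cardsCs setCK cU card_ord /t; lia.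
  move: dx d1c; rewrite /deg -/A /c.
  by move: #|A| #|A :&: _| #|~: _ :|: _| => ? ? ?; lia.
- by rewrite BP inE => /andP[].
pose Z l := Y l :\: covered C l.
have CYs l : covered C l \subset Y l.
  by apply/subsetP => x; rewrite inE => /mapP[f fC ->]; apply: CY.
pose z := t - k * a - size C.
have cZ l : #|Z l| = z by rewrite cardsD (setIidPr (CYs l)) card_covered // cY.
have [D [sD cD DZ uD]] : exists D : seq tile, [/\ size D = z - c,
    forall f, f \in D -> clique E f, forall f l, f \in D -> f l \in Z l & tile_disjoint D].
  case: (leqP c z) => [cz|/ltnW]; last first.
    by rewrite -subn_eq0 => /eqP ->; exists [::]; split.
  by apply: (greedy fc) => l; rewrite cZ subnKC.
have DZs l : covered D l \subset Z l.
  by apply/subsetP => x; rewrite inE => /mapP[f fC ->]; apply: DZ.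
(* This is the minimum of [z] and [c], which also covers [z < c], where [D] is empty. Since [d] is
   at least [2 * c], each leftover vertex has the [c + n] exchanges that [absorb] asks for. *)
pose n := z - (z - c).
pose W l := enum (Z l :\: covered D l).
pose S := [seq (p.1, q p) | p <- enum {: 'I_k * 'I_a}].
have WZ l x : x \in W l -> x \in Z l /\ x \notin covered D l.
  by rewrite mem_enum inE => /andP[].
have mapS l : [seq p.2 l | p : 'I_k * tile <- S] = [seq q p l | p <- enum {: 'I_k * 'I_a}].
  by rewrite -map_comp.
have l0 : 'I_k by exists 0; apply: ltnW.
have [|||||T [sT cT uT]] := absorb Esym l0 fc (n := n) (S := S) (O := C ++ D) (W := W).
- move=> l; rewrite mapS map_cat cat_uniq map_inj_uniq; last exact: (qI l).
  rewrite enum_uniq /=.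
  rewrite cat_uniq cat_uniq uC uD enum_uniq /= !andbT.
  apply/and3P; split.
  + apply/hasPn => x xCDW; apply/negP => /mapP[p _ xp].
    have : x \in R l by rewrite xp; apply/imsetP; exists p.
    suff : x \in Y l by rewrite inE => /andP[/negP].
    move: xCDW; rewrite !mem_cat => /orP[/orP[]|/WZ[+ _]].
    * by move=> /mapP[f /(CY _ l) + ->]; apply.
    * by move=> /mapP[f /(DZ _ l) + ->]; rewrite inE => /andP[].
    * by rewrite inE => /andP[].
  + apply/hasPn => x /mapP[f /(DZ _ l) + ->]; rewrite inE => /andP[+ _].
    by rewrite inE.
  + apply/hasPn => x /WZ[+ xD]; rewrite !inE => /andP[xC _].
    rewrite /= mem_cat negb_or; move: xC xD; rewrite !inE => -> ->; done.
- by move=> _ /mapP[p _ ->]; apply: cq.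
- by move=> f; rewrite mem_cat => /orP[/cC|/cD].
- by move=> l; rewrite -cardE cardsD (setIidPr (DZs l)) card_covered // cZ sD.
- move=> l w /WZ[wZ _]; move: wZ; rewrite inE => /andP[wC wY].
  have wb : w \notin bad l.
    by apply: contra wC => wb; apply: (BC (l, w)); rewrite BP.
  move: wb; rewrite inE wY -leqNgt => dw.
  apply: leq_trans (_ : d <= _); first by move: dc; rewrite /n -/c; move: (z) (c) => ? ?; lia.
  apply: leq_trans dw _; rewrite -size_filter.
  have -> : #|[set b | completes E l w (q (l, b))]| =
      size [seq (l, q (l, b)) | b <- enum [set b | completes E l w (q (l, b))]].
    by rewrite size_map -cardE.
  apply: uniq_leq_size.
    rewrite map_inj_uniq ?enum_uniq // => b b' [e1]; have := qI l (l, b) (l, b').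
    by rewrite e1 => /(_ erefl) [].
  move=> _ /mapP[b + ->]; rewrite mem_enum inE => bc.
  by rewrite mem_filter /= eqxx bc; apply/mapP; exists (l, b); rewrite ?mem_enum.
exists T; split=> //; rewrite sT size_map -cardE card_prod !card_ord size_cat sD /n /z /t.
move: sC sB d1c d1m; rewrite /t.
by move: (size C) (size B) (k * a) (k * r) (c) => *; lia.
Qed.

End PerfectTiling.

(** * Random orientations *)

Definition swap_pair (T : Type) (p : T * T) : T * T := (p.2, p.1).

Section Prob.
Variables (k : nat) (n : nat -> nat).
Notation V := (vtx k n).
Notation Or := (orientations k n).

Lemma orientationP (A : {ffun V * V -> bool}) :
  reflect ((forall u v, A (u, v) -> tag u != tag v) /\
           (forall u v, tag u != tag v -> A (u, v) = ~~ A (v, u)))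
          (A \in Or).
Proof.
rewrite inE; apply: (iffP forallP) => [H|[H1 H2] u].
  split=> u v; have /forallP/(_ v)/andP[/implyP H1 /implyP H2] := H u => //.
  by move=> /H2; case: (A (u, v)); case: (A (v, u)).
apply/forallP => v; apply/andP; split; apply/implyP; first exact: H1.
by move=> /H2 ->; case: (A (v, u)).
Qed.

Lemma orientations_gt0 : 0 < #|Or|.
Proof.
rewrite card_gt0; apply/set0Pn; exists [ffun p : V * V => tag p.1 < tag p.2].
apply/orientationP; split=> u v; rewrite !ffunE /=.
  by move=> uv; apply/eqP => e; rewrite e ltnn in uv.
by rewrite -val_eqE /= -leqNgt ltn_neqAle => ->.
Qed.

Section Uniform.
Variables (P J : finType) (e : P -> J -> V * V).
Hypothesis e_tag : forall p j, tag (e p j).1 != tag (e p j).2.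
Hypothesis e_inj : forall p j p' j',
  e p j = e p' j' \/ e p j = swap_pair (e p' j') -> p = p' /\ j = j'.

Notation pattern := {ffun P -> {ffun J -> bool}}.

Definition bits (A : {ffun V * V -> bool}) : pattern :=
  [ffun p => [ffun j => A (e p j)]].

(* Flipping the arcs where b and b' disagree maps one fibre into the other. *)
Lemma fiber_le (b b' : pattern) :
  #|[set A in Or | bits A == b]| <= #|[set A in Or | bits A == b']|.
Proof.
pose s (q : V * V) := [exists p, exists j, (b p j != b' p j) &&
   ((q == e p j) || (q == swap_pair (e p j)))].
have s_sym u v : s (u, v) = s (v, u).
  apply: eq_existsb => p; apply: eq_existsb => j; congr (_ && _).
  by rewrite orbC; case: (e p j) => x y; rewrite /swap_pair /= !xpair_eqE (andbC (u == y)) (andbC (u == x)).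
have s_tag u v : s (u, v) -> tag u != tag v.
  move=> /existsP[p /existsP[j /andP[_]]]; have := e_tag p j; case: (e p j) => x y /= xy.
  by rewrite !xpair_eqE => /orP[] /andP[/eqP-> /eqP->] //; rewrite eq_sym.
have s_e p j : s (e p j) = (b p j != b' p j).
  apply/existsP/idP => [[p' /existsP[j' /andP[bb H]]]|bb].
    have [-> ->] // : p = p' /\ j = j'.
    by apply: e_inj; case/orP: H => /eqP; [left|right].
  by exists p; apply/existsP; exists j; rewrite bb eqxx.
pose flip (A : {ffun V * V -> bool}) := [ffun q => A q (+) s q].
have flipK : involutive flip by move=> A; apply/ffunP => q; rewrite !ffunE -addbA addbb addbF.
rewrite -(card_imset _ (inv_inj flipK)); apply/subset_leq_card/subsetP => _ /imsetP[A + ->].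
rewrite inE => /andP[/orientationP[A1 A2] /eqP Ab]; rewrite inE; apply/andP; split.
  apply/orientationP; split=> u v; rewrite !ffunE.
    by case Auv: (A (u, v)) => /=; [move=> _; apply: A1|apply: s_tag].
  by move=> /A2 ->; rewrite (s_sym u) addNb.
apply/eqP/ffunP => p; apply/ffunP => j; rewrite !ffunE s_e -Ab !ffunE.
by case: (A _); case: (b' p j).
Qed.

(** By [fiber_le] in both directions all fibres of [bits] have the same size, so the pattern of a
    random orientation is uniform. *)
Lemma uniform_bits (Q : pred pattern) :
  #|[set A in Or | Q (bits A)]| * #|{: pattern}| = #|Or| * #|[set b | Q b]|.
Proof.
pose b0 : pattern := [ffun=> [ffun=> false]].
pose N b := #|[set A in Or | bits A == b]|.
have NE b : N b = N b0 by apply/eqP; rewrite eqn_leq !fiber_le.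
have cardE (Q' : pred pattern) : #|[set A in Or | Q' (bits A)]| = #|[set b | Q' b]| * N b0.
  rewrite -sum1_card (partition_big bits Q') => [|A]; last by rewrite inE => /andP[].
  rewrite -sum_nat_const; apply: eq_big => [b|b Qb]; first by rewrite inE.
  rewrite -(NE b) sum1dep_card /N; apply: eq_card => A; rewrite !inE.
  by case: (bits A =P b) => [->|]; rewrite ?Qb ?andbF ?andbT.
have -> : #|Or| = #|{: pattern}| * N b0.
  transitivity (#|[set A in Or | predT (bits A)]|); first by apply: eq_card => A; rewrite !inE andbT.
  by rewrite cardE; congr (_ * _); rewrite -cardsT; apply: eq_card => b; rewrite !inE.
rewrite cardE; lia.
Qed.

End Uniform.

Lemma weight_sum (J : finType) :
  \sum_(g : {ffun J -> bool}) (if [forall j, g j] then 1 else 2) = (2 ^ #|J|.+1).-1.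
Proof.
have H : \sum_(g : {ffun J -> bool}) (if [forall j, g j] then 1 else 2) + 1 = 2 ^ #|J|.+1.
  pose g0 : {ffun J -> bool} := [ffun=> true].
  have full (g : {ffun J -> bool}) : [forall j, g j] = (g == g0).
    apply/forallP/eqP => [H|-> j]; last by rewrite ffunE.
    by apply/ffunP => j; rewrite ffunE; apply: H.
  rewrite (bigD1 g0) //= full eqxx addnC addnA.
  have -> : \sum_(i | i != g0) (if [forall j, i j] then 1 else 2) = \sum_(i in predC1 g0) 2.
    by apply: eq_big => // g /negbTE gg; rewrite full gg.
  rewrite sum_nat_const (cardC1 g0) card_ffun card_bool expnS.
  have : 0 < 2 ^ #|J| by rewrite expn_gt0.
  by move: (2 ^ _) => x; lia.
by rewrite -H addn1.
Qed.

(* Exponential moment: each full pattern has weight 1, the others weight 2. *)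
Lemma few_full_patterns (R B J : finType) (d : nat) :
  #|[set b : {ffun R * B -> {ffun J -> bool}} |
      [forall v, #|[set y | [forall j, b (v, y) j]]| < d]]| * 2 ^ (#|R| * #|B|)
  <= 2 ^ (d * #|R|) * (2 ^ #|J|.+1).-1 ^ (#|R| * #|B|).
Proof.
pose w (g : {ffun J -> bool}) := if [forall j, g j] then 1 else 2.
have -> : (2 ^ #|J|.+1).-1 ^ (#|R| * #|B|) =
    \sum_(b : {ffun R * B -> {ffun J -> bool}}) \prod_p w (b p).
  rewrite -weight_sum -card_prod -prod_nat_const.
  exact: (bigA_distr_bigA (fun (p : R * B) (g : {ffun J -> bool}) => w g)).
set S := [set b | _]; rewrite big_distrr /= -[#|S| * _]sum_nat_const.
rewrite [leqRHS](bigID (mem S)) /=.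
apply: leq_trans (leq_addr _ _); apply: leq_sum => b; rewrite inE => /forallP Hb.
rewrite (mulnC #|R|) !expnM.
have -> : \prod_(p : R * B) w (b p) = \prod_v \prod_y w (b (v, y)).
  by rewrite pair_bigA; apply: eq_bigr => -[].
rewrite -[(2 ^ #|B|) ^ _]prod_nat_const -[(2 ^ d) ^ _]prod_nat_const -big_split /=; apply: leq_prod => v _.
(* A row with fewer than [d] full patterns has more than [#|B| - d] entries of weight 2, so it loses
   at most a factor [2 ^ d] against [2 ^ #|B|]. *)
have -> : \prod_y w (b (v, y)) = 2 ^ #|[set y | ~~ [forall j, b (v, y) j]]|.
  rewrite -prod_nat_const big_mkcond [RHS]big_mkcond; apply: eq_bigr => y _.
  by rewrite inE /w; case: ifP.
rewrite -expnD leq_exp2l //; have := Hb v; set A := [set y | [forall j, _]].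
have -> : [set y | ~~ [forall j, b (v, y) j]] = ~: A by apply/setP => y; rewrite !inE.
by rewrite -(cardsC A) => /ltnW; rewrite leq_add2r.
Qed.

(** The first two terms of a binomial expansion give [(1 - 1/M)^M <= 1/2], which is then squared. *)
Lemma pow_ratio M : 1 < M -> 4 * M.-1 ^ (2 * M) <= M ^ (2 * M).
Proof.
case: M => // M M1; have H : 2 * M ^ M.+1 <= M.+1 ^ M.+1.
  have -> : M.+1 ^ M.+1 = (M + 1) ^ M.+1 by rewrite addn1.
  rewrite expnDn 2!big_ord_recl /= !exp1n !muln1 /= bin0 mul1n bin1 subn0.
  rewrite addnA; apply: leq_trans (leq_addr _ _).
  by rewrite /bump /= subn1 /= expnS; nia.
by rewrite (mulnC 2) !expnM -[4]/(2 ^ 2) -expnMn leq_exp2r.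
Qed.

(** Markov's inequality for the exponential moment. The size of [B] makes the expected number of
    full patterns in a row equal to [4 * d]; by [pow_ratio] the normalised moment is at most
    [4 ^ -(d * #|R|)], and the threshold costs back [2 ^ (d * #|R|)]. *)
Lemma few_bad_orientations (R B J : finType) (e : R * B -> J -> V * V) (d : nat) :
  (forall p j, tag (e p j).1 != tag (e p j).2) ->
  (forall p j p' j', e p j = e p' j' \/ e p j = swap_pair (e p' j') -> p = p' /\ j = j') ->
  #|B| = 2 * 2 ^ #|J|.+1 * d ->
  #|[set A in Or | [forall v, #|[set y | [forall j, A (e (v, y) j)]]| < d]]| * 2 ^ (d * #|R|)
  <= #|Or|.
Proof.
move=> et ei cB; set bad := #|_|; set M := 2 ^ #|J|.+1 in cB.
have M1 : 1 < M by rewrite -[1]/(2 ^ 0) ltn_exp2l.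
have := uniform_bits et ei (fun b => [forall v, #|[set y | [forall j, b (v, y) j]]| < d]).
have -> : #|[set A in Or | [forall v, #|[set y | [forall j, bits e A (v, y) j]]| < d]]| = bad.
  apply: eq_card => A; rewrite !inE; congr (_ && _); apply: eq_forallb => v.
  congr (_ < _); apply: eq_card => y; rewrite !inE; apply: eq_forallb => j.
  by rewrite !ffunE.
have := few_full_patterns R B J d; set cnt := #|[set b | _]| => cntP.
rewrite !card_ffun card_bool card_prod => badE.
have H1 : bad * M ^ (#|R| * #|B|) <= #|Or| * (2 ^ (d * #|R|) * M.-1 ^ (#|R| * #|B|)).
  have -> : M ^ (#|R| * #|B|) = 2 ^ (#|R| * #|B|) * (2 ^ #|J|) ^ (#|R| * #|B|).
    by rewrite -expnMn -expnS.
  rewrite mulnCA badE mulnCA leq_mul2l mulnC; apply/orP; right.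
  exact: cntP.
have H2 : 4 ^ (d * #|R|) * M.-1 ^ (#|R| * #|B|) <= M ^ (#|R| * #|B|).
  have -> : #|R| * #|B| = (2 * M) * (d * #|R|) by rewrite cB; lia.
  rewrite !(expnM _ (2 * M)) -expnMn.
  by case: (posnP (d * #|R|)) => [->|?]; rewrite ?expn0 // leq_exp2r // pow_ratio.
have M0 : 0 < M.-1 ^ (#|R| * #|B|) by rewrite expn_gt0; lia.
have T0 : 0 < 2 ^ (d * #|R|) by rewrite expn_gt0.
have H3 := leq_trans (leq_mul (leqnn bad) H2) H1.
rewrite -(leq_pmul2r T0) -(leq_pmul2r M0); apply: leq_trans (leq_trans H3 _); last by rewrite mulnA.
by rewrite -[4]/(2 * 2) expnMn !mulnA.
Qed.

End Prob.

(** * Feedback arc sets and linear orders *)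

Lemma all_cycle_arcs (V : finType) (r : rel V) (c : seq V) :
  cycle r c = all (fun p => r p.1 p.2) (cycle_arcs c).
Proof.
case: c => // x p; rewrite /cycle_arcs rot1_cons /=.
suff H y z : path r y (rcons p z) = all (fun q => r q.1 q.2) (zip (y :: p) (rcons p z)).
  exact: H.
by elim: p y => [|w p IH] y //=; rewrite IH.
Qed.

Lemma increasing_not_cycle (V : finType) (r : rel V) (pos : V -> nat) (c : seq V) :
  (forall u v, r u v -> pos u < pos v) -> c != [::] -> ~ cycle r c.
Proof.
case: c => // x p H _ /(sub_path H) /=.
move=> /(order_path_min (fun b a c => @ltn_trans (pos b) (pos a) (pos c))).
by rewrite all_rcons ltnn.
Qed.

(** Vertices are ranked by the number of vertices they reach, ties broken by [enum_rank]; this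
    number drops along an arc, since a way back would close a cycle. The finite codomain lets a
    union bound range over the orders. *)
Lemma acyclic_rank (V : finType) (e : rel V) :
  (forall c, ~ directed_cycle e c) ->
  exists rho : {ffun V -> 'I_(#|V|.+1 * #|V|)},
    injective rho /\ forall u v, e u v -> rho v < rho u.
Proof.
move=> acyc; pose h u := #|[set v | connect e u v]|.
have h_lt u v : e u v -> h v < h u.
  move=> euv; apply: proper_card; apply/properP; split.
    by apply/subsetP => w; rewrite !inE; apply: connect_trans (connect1 euv).
  exists u; rewrite !inE ?connect0 //; apply/negP => /connectP[p pe pl].
  case/shortenP: pe pl => p' pe up _ pl; apply: (acyc (v :: p')); split => //.
  by rewrite /= rcons_path pe -pl.
have V_gt0 (u : V) : 0 < #|V| by apply/card_gt0P; exists u.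
have bnd (u : V) : h u * #|V| + enum_rank u < #|V|.+1 * #|V|.
  have : h u <= #|V| by apply: max_card.
  by move=> hV; rewrite mulSn addnC -addSn leq_add ?ltn_ord // leq_mul2r hV orbT.
pose rho := [ffun u : V => Ordinal (bnd u)].
exists rho; split=> [u v|u v /h_lt huv]; rewrite !ffunE.
  move=> [uv]; apply: enum_rank_inj; apply: val_inj => /=.
  by have /(congr1 (modn^~ #|V|)) := uv; rewrite !modnMDl !modn_small // ltn_ord.
change (h v * #|V| + enum_rank v < h u * #|V| + enum_rank u).
apply: (@leq_trans ((h v).+1 * #|V|)).
  by rewrite mulSn [ltnLHS]addnC -addSn leq_add2r ltn_ord.
by apply: leq_trans (leq_addr _ _); rewrite leq_mul2r huv orbT.
Qed.

(** * Upper bound: deleting a star forest *)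

Section Graph.
Variables (k : nat) (n : nat -> nat) (A : {ffun vtx k n * vtx k n -> bool}).
Hypothesis AO : A \in orientations k n.
Notation V := (vtx k n).
Notation arc := (fun u v => A (u, v)).

Lemma vtx_eq (u v : V) : tag u = tag v -> (tagged u : nat) = tagged v -> u = v.
Proof.
case: u v => [i x] [j y] /= ij; move: y; rewrite -ij => y xy.
by congr (Tagged _ _); apply: val_inj.
Qed.

(* The leaves of the star centred at the i-th vertex of the last class are the
   vertices of the i-th class. *)
Definition star_arc (L : 'I_k) (p : V * V) : bool :=
  [&& tag p.1 == L, tag p.2 != L & tagged p.1 == tag p.2 :> nat].

Lemma fk_prop_le t : 1 < k -> k <= n k.-1 -> fk_prop arc k t -> t <= n k.-1 - k + 1.
Proof.
move=> k1 kn; have /orientationP[Atag Aanti] := AO.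
have Lk : k.-1 < k by lia.
pose L : 'I_k := Ordinal Lk.
pose Z := star_arc L.
have Zuniq s s' v : Z (s, v) -> Z (s', v) -> s = s'.
  move=> /and3P[/= /eqP s1 _ /eqP s2] /and3P[/= /eqP s'1 _ /eqP s'2].
  by apply: vtx_eq; rewrite ?s1 ?s2.
pose F := [set p | [&& A p, ~~ Z p & ~~ Z (swap_pair p)]].
have FF : feedback_arc_set arc F.
  split=> [[u v]|c [c0 _ cA]]; first by rewrite inE => /and3P[].
  apply/negPn/negP; rewrite -all_predC => cF.
  (* A cycle missing [F] would consist of star arcs. This potential increases along them: class [L]
     gets 1, a leaf gets 2 or 0 according to the direction of its only star arc. *)
  pose pos (v : V) := if tag v == L then 1 else
    if [exists s, Z (s, v) && A (s, v)] then 2 else 0.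
  pose r u v := A (u, v) && (Z (u, v) || Z (v, u)).
  apply: (@increasing_not_cycle _ r pos c) => //; last first.
    rewrite all_cycle_arcs; apply/allP => -[u v] uv; rewrite /r /=.
    have Auv : A (u, v) by move: cA; rewrite all_cycle_arcs => /allP/(_ _ uv).
    rewrite Auv /=; move: cF => /allP/(_ _ uv) /=; rewrite inE /swap_pair /=.
    rewrite Auv.
    by case: (Z (u, v)) => //=; case: (Z _).
  move=> u v /andP[Auv /orP[] Zuv]; case/and3P: (Zuv) => /= u1 v1 _.
    rewrite /pos u1 (negbTE v1); case: existsP => // -[].
    by exists u; rewrite Zuv.
  rewrite /pos u1 (negbTE v1); case: existsP => // -[s /andP[Zs As]].
  have Avu : A (v, u) by rewrite -(Zuniq _ _ _ Zs Zuv).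
  by move: (Auv); rewrite (Aanti u v (Atag _ _ Auv)) Avu.
move=> /(_ F FF)[g [gI gF]].
have gF' a i j : i != j -> (g a i, g a j) \in F \/ (g a j, g a i) \in F.
  by rewrite neq_ltn => /orP[] /gF; [left|right].
have tagI a : injective (fun i => tag (g a i)).
  move=> i j e; apply/eqP/negPn/negP => /(gF' a) []; rewrite inE => /and3P[/Atag + _ _];
  by rewrite e eqxx.
have tagS a j : exists i, tag (g a i) == j.
  have /(_ j) := injF_onto (tagI a) => /codomP[i ->]; exists i; exact: eqxx.
have /fin_all_exists[h hP] : forall a, exists i, tag (g a i) == L by move=> a; apply: tagS.
pose val_ a : nat := tagged (g a (h a)).
have tagL a : tag (g a (h a)) = L by apply/eqP.
(* The clique meets every class. If its vertex in class [L] were a star centre, its vertex in the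
   class of the leaves would be joined to it by a deleted arc. *)
have valge a : k.-1 <= val_ a.
  rewrite leqNgt; apply/negP => vk.
  have vk' : val_ a < k by apply: ltn_trans vk _.
  have [i' /eqP i'P] := tagS a (Ordinal vk').
  have Zi : Z (g a (h a), g a i').
    by apply/and3P; split; rewrite /= ?tagL ?i'P // -val_eqE /= neq_ltn vk.
  have hi : h a != i'.
    apply/eqP => e; move: Zi; rewrite e => /and3P[/= + /negP]; tauto.
  by case: (gF' a _ _ hi); rewrite inE /swap_pair /= Zi ?andbF.
have vallt a : val_ a < n k.-1.
  by have := ltn_ord (tagged (g a (h a))); rewrite {2}tagL.
have valI : injective val_.
  move=> a b e; have [] // := gI a (h a) b (h b).
  by apply: vtx_eq; rewrite ?tagL.
have : size [seq val_ a | a <- enum 'I_t] <= size (iota k.-1 (n k.-1 - k.-1)).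
  apply: uniq_leq_size; first by rewrite map_inj_uniq ?enum_uniq.
  move=> _ /mapP[a _ ->]; rewrite mem_iota valge subnKC ?vallt //; lia.
by rewrite size_map size_enum_ord size_iota; lia.
Qed.

(** * Lower bound: forward arcs of a linear order *)

Section Lower.
Variables (m N : nat) (mn : forall i : 'I_k, m <= n i).

Definition emb (u : 'I_k * 'I_m) : V :=
  Tagged (fun i : 'I_k => 'I_(n i)) (widen_ord (mn u.1) u.2).

Lemma emb_inj : injective emb.
Proof.
move=> [i x] [j y] e; have ij : i = j := congr1 tag e.
by have xy : (x : nat) = y := congr1 (fun v : V => tagged v : nat) e; rewrite ij (val_inj xy).
Qed.

(** Both branches query the arc that would point forward in [rho], so for injective [rho] this is an
    undirected graph, and for fixed [rho] each pair of vertices from different classes reads one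
    fair bit. *)
Definition fwd (rho : {ffun 'I_k * 'I_m -> 'I_N}) : rel ('I_k * 'I_m) :=
  fun u v => if rho u < rho v then A (emb u, emb v) else A (emb v, emb u).

Lemma fwd_sym (rho : {ffun 'I_k * 'I_m -> 'I_N}) : injective rho -> symmetric (fwd rho).
Proof.
move=> rI u v; rewrite /fwd; case: ltngtP => // /val_inj/rI ->.
by [].
Qed.

(* If x precedes x' in the order, then an arc path x -> y -> x' contains an arc
   that is forward, wherever y is placed. *)
Lemma fwd_degree (rho : {ffun 'I_k * 'I_m -> 'I_N}) (d : nat) (i j : 'I_k) x x' : injective rho -> 
  (forall x x', x != x' -> 2 * d <=
    #|[set y | A (emb (i, x), emb (j, y)) && A (emb (j, y), emb (i, x'))]|) ->
  x != x' ->
  d <= #|[set y | fwd rho (i, x) (j, y)]| \/ d <= #|[set y | fwd rho (i, x') (j, y)]|.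
Proof.
move=> rI H; wlog lt : x x' / rho (i, x) < rho (i, x') => [W xx'|].
  case: (ltngtP (rho (i, x)) (rho (i, x'))) => [lt|lt|/val_inj/rI[e]].
  - exact: W.
  - by case: (W x' x lt); rewrite 1?eq_sym //; [right|left].
  - by rewrite e eqxx in xx'.
move=> /H; set S := [set y | _ && _] => HS.
have : #|S| <= #|[set y | fwd rho (i, x) (j, y)]| + #|[set y | fwd rho (i, x') (j, y)]|.
  apply: leq_trans (leq_card_setU _ _); apply/subset_leq_card/subsetP => y.
  rewrite !inE /fwd => /andP[xy yx']; case: ltnP => // yx; first by rewrite xy.
  by rewrite ltnNge (leq_trans yx (ltnW lt)) /= yx' orbT.
move: #|_| #|_| #|_| HS => a b c; lia.
Qed.

(** Listing a clique of [fwd rho] by increasing [rho] makes all its arcs point forward, hence lie in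
    [F]. *)
Lemma disjoint_TT_of_tiling (F : {set V * V}) (rho : {ffun 'I_k * 'I_m -> 'I_N}) (T : seq {ffun 'I_k -> 'I_m}) t :
  injective rho ->
  (forall u v, A (emb u, emb v) -> rho u < rho v -> (emb u, emb v) \in F) ->
  size T = t -> (forall f, f \in T -> clique (fwd rho) f) -> tile_disjoint T ->
  has_disjoint_TT k t F.
Proof.
move=> rI rF sT cT uT.
pose f (a : 'I_t) : {ffun 'I_k -> 'I_m} := tnth (in_tuple T) (cast_ord (esym sT) a).
have fT a : f a \in T by apply: mem_tnth.
have fI a b i : f a i = f b i -> a = b.
  move=> e; apply: val_inj.
  have := uT i => /(uniqP (f a i)) /(_ a b).
  rewrite !inE size_map sT => /(_ (ltn_ord _) (ltn_ord _)); apply.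
  have nthf (x : 'I_t) : nth (f a i) [seq g i | g : {ffun 'I_k -> 'I_m} <- T] x = f x i.
    have -> : f x = nth (f a) T x by apply: tnth_nth.
    by rewrite (nth_map (f a)) // sT.
  by rewrite !nthf.
pose le a := fun i j : 'I_k => rho (i, f a i) <= rho (j, f a j).
pose s a := sort (le a) (enum 'I_k).
have szs a : size (s a) = k by rewrite size_sort size_enum_ord.
have us a : uniq (s a) by rewrite sort_uniq enum_uniq.
have ss a : sorted (le a) (s a) by apply: sort_sorted => i j; apply: leq_total.
pose o a (i : 'I_k) := nth i (s a) i.
have oE a (i j : 'I_k) : o a i = nth j (s a) i by apply: set_nth_default; rewrite szs.
have oI a (i j : 'I_k) : o a i = o a j -> i = j.
  rewrite (oE a i i) (oE a j i) => /eqP; rewrite nth_uniq ?szs ?us //.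
  by move=> /eqP/val_inj.
exists (fun a i => emb (o a i, f a (o a i))); split=> [a i b j|a i j ij].
  move=> /emb_inj [oo]; rewrite oo => /fI ab; subst b.
  by split=> //; apply: oI oo.
have oij : o a i != o a j.
  by apply/eqP => /oI e; rewrite e ltnn in ij.
have rij : rho (o a i, f a (o a i)) < rho (o a j, f a (o a j)).
  rewrite ltn_neqAle; apply/andP; split.
    by apply/eqP => /val_inj/rI [e _]; rewrite e eqxx in oij.
  rewrite (oE a i i) (oE a j i).
  apply: (@sorted_leq_nth _ (le a) _ _ _ _ (ss a)); rewrite ?inE ?szs //.
  - by move=> x y z; apply: leq_trans.
  - by move=> x; apply: leqnn.
  - exact: ltnW.
apply: rF => //; have /cliqueP/(_ _ _ oij) := cT _ (fT a).
by rewrite /fwd rij.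
Qed.

(** The arcs outside [F] contain no cycle, and [acyclic_rank] makes them all go down in [rho]. *)
Lemma feedback_rank (F : {set V * V}) : N = #|{: 'I_k * 'I_m}|.+1 * #|{: 'I_k * 'I_m}| ->
  feedback_arc_set arc F -> exists rho : {ffun 'I_k * 'I_m -> 'I_N}, injective rho /\
  forall u v, A (emb u, emb v) -> rho u < rho v -> (emb u, emb v) \in F.
Proof.
move=> -> [_ FF].
have [c [c0 uc cc]|rho [rI rF]] := @acyclic_rank _ (fun u v => A (emb u, emb v) && ((emb u, emb v) \notin F)).
  have /hasP[p] : has (fun p => p \in F) (cycle_arcs (map emb c)).
    apply: FF; split; first by case: c c0 {uc cc}.
      by rewrite map_inj_uniq // => u v; apply: emb_inj.
    by rewrite cycle_map; apply: sub_cycle cc => u v /= /andP[].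
  have : cycle (fun u v => (u, v) \notin F) (map emb c).
    by rewrite cycle_map; apply: sub_cycle cc => u v /= /andP[].
  rewrite all_cycle_arcs => /allP H /H /=; case: p => u v /= /negP; tauto.
exists rho; split=> // u v Auv uv; apply/negPn/negP => nF.
by have := rF u v; rewrite Auv nF => /(_ isT) /ltnW; rewrite leqNgt uv.
Qed.

End Lower.
End Graph.

(** * Union bounds *)

Lemma card_bigcup_le (T X : finType) (B : T -> {set X}) (K O : nat) :
  (forall p, #|B p| * K <= O) -> #|\bigcup_p B p| * K <= #|T| * O.
Proof.
move=> H; apply: leq_trans (_ : \sum_(p : T) #|B p| * K <= _).
  rewrite -big_distrl /= leq_mul2r; apply/orP; right.
  elim/big_ind2: _ => [|S1 m1 S2 m2 H1 H2|//]; first by rewrite cards0.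
  exact: leq_trans (leq_card_setU _ _) (leq_add H1 H2).
by rewrite -sum_nat_const; apply: leq_sum.
Qed.

(** With [x] half of [e], one factor [2 ^ x] beats [x] and the other, by induction, beats the
    remaining power with its constant. *)
Lemma poly_le_exp (D C : nat) : exists E0, forall e, E0 <= e -> C * e ^ D <= 2 ^ e.
Proof.
elim: D C => [|D IH] C.
  by exists C => e Ce; rewrite muln1 (leq_trans Ce) // ltnW // ltn_expl.
have [E0 H] := IH (C * 3 ^ D.+1); exists (2 * E0 + 2) => e He.
pose x := e./2.
have xe : e <= 3 * x /\ 2 * x <= e by rewrite /x; lia.
have := H x; rewrite /x => /(_ ltac:(lia)); rewrite -/x => Hx.
apply: leq_trans (_ : C * (3 * x) ^ D.+1 <= _).
  by rewrite leq_mul2l leq_exp2r // xe.1 orbT.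
rewrite expnMn (expnS x) mulnA mulnCA mulnC.
apply: leq_trans (_ : 2 ^ x * 2 ^ x <= _).
  by rewrite leq_mul // ltnW // ltn_expl.
by rewrite -expnD leq_exp2l //; lia.
Qed.

Section Random.
Variables (k : nat) (n : nat -> nat) (m N : nat).
Hypothesis mn : forall i : 'I_k, m <= n i.
Notation V := (vtx k n).
Notation Or := (orientations k n).
Notation em := (emb mn).

Lemma emb_pair u v u' v' : (em u, em v) = (em u', em v') -> u = u' /\ v = v'.
Proof. by move=> e; move: (congr1 fst e) (congr1 snd e) => /= /emb_inj ? /emb_inj. Qed.

(** The side conditions belong to the event, which is empty for degenerate parameters, so the union
    bound runs over a whole finite type; [not_spread_ev] follows the same pattern. *)
Definition no_path_ev (d : nat) (p : 'I_k * 'I_k * 'I_m * 'I_m) : {set {ffun V * V -> bool}} :=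
  let: (i, j, x, x') := p in
  [set A in Or | [&& i != j, x != x' &
    #|[set y | A (em (i, x), em (j, y)) && A (em (j, y), em (i, x'))]| < d]].

Lemma card_no_path d p : 16 * d <= m -> #|no_path_ev d p| * 2 ^ d <= #|Or|.
Proof.
case: p => [[[i j] x] x'] dm; rewrite /no_path_ev.
case: (eqVneq i j) => [ij|ij].
  by rewrite (_ : [set _ in _ | _] = set0) ?cards0 //; apply/setP => A; rewrite !inE andbF.
case: (eqVneq x x') => [xx|xx].
  by rewrite (_ : [set _ in _ | _] = set0) ?cards0 //; apply/setP => A; rewrite !inE andbF.
(* Each [y] involves two arcs, so [few_bad_orientations] asks for [2 * 2 ^ 3 * d = 16 * d] vertices
   [y]. *)
pose w (b : 'I_(16 * d)) : 'I_m := widen_ord dm b.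
have wI : injective w by move=> b b' /(congr1 val) /= /val_inj.
pose e (p : unit * 'I_(16 * d)) (t : bool) : V * V :=
  if t then (em (i, x), em (j, w p.2)) else (em (j, w p.2), em (i, x')).
have et p t : tag (e p t).1 != tag (e p t).2.
  by case: t; rewrite /e /= // eq_sym.
have ei p t p' t' : e p t = e p' t' \/ e p t = swap_pair (e p' t') -> p = p' /\ t = t'.
  have xx' : (x' == x) = false by rewrite eq_sym (negbTE xx).
  have ij' : (j == i) = false by rewrite eq_sym (negbTE ij).
  case: p p' => [[] b] [[] b']; case: t; case: t'; rewrite /e /swap_pair /= => H;
    have {H} [/emb_pair[e1 e2]|/emb_pair[e1 e2]] := H; move/eqP: e1; move/eqP: e2;
    rewrite !xpair_eqE ?(inj_eq wI) ?eqxx ?(negbTE ij) ?ij' ?(negbTE xx) ?xx' ?andbF //=.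
  - by move=> /eqP -> _.
  - by move=> _ /eqP ->.
have := @few_bad_orientations k n unit 'I_(16 * d) bool e d et ei.
rewrite card_unit muln1 card_bool card_ord => /(_ erefl); apply: leq_trans.
rewrite leq_mul2r; apply/orP; right; apply/subset_leq_card/subsetP => A.
rewrite !inE => /andP[-> /= H]; apply/forallP => -[]; apply: leq_ltn_trans H.
rewrite -(card_imset _ wI); apply/subset_leq_card/subsetP => _ /imsetP[b + ->].
by rewrite !inE => /forallP H; rewrite (H true) (H false).
Qed.

Definition not_spread_ev (d a r : nat)
    (p : {ffun 'I_k * 'I_m -> 'I_N} * 'I_k * {ffun 'I_a -> {ffun 'I_k -> 'I_m}} *
         {ffun 'I_r -> 'I_m}) : {set {ffun V * V -> bool}} :=
  let: (rho, i, q, x) := p in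
  [set A in Or | [&& injectiveb x, [forall j, injectiveb [ffun b => q b j]] &
    [forall v, #|[set b | completes (fwd A mn rho) i (x v) (q b)]| < d]]].

Lemma card_not_spread d a r p : a = 2 * 2 ^ k * d ->
  #|@not_spread_ev d a r p| * 2 ^ (d * r) <= #|Or|.
Proof.
case: p => [[[rho i] q] x] ad; rewrite /not_spread_ev.
case: (boolP (injectiveb x)) => [/injectiveP xI|xI]; last first.
  by rewrite (_ : [set _ in _ | _] = set0) ?cards0 //; apply/setP => A; rewrite !inE andbF.
case: (boolP [forall j, injectiveb [ffun b => q b j]]) => [/forallP qI|qI]; last first.
  by rewrite (_ : [set _ in _ | _] = set0) ?cards0 //; apply/setP => A; rewrite !inE andbF.
have {}qI j b b' : q b j = q b' j -> b = b'.
  by move=> e; have /injectiveP := qI j; apply; rewrite !ffunE.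
pose J : finType := {j : 'I_k | j != i}.
have cJ : #|J|.+1 = k.
  by rewrite card_sig (eq_card (_ : _ =i predC1 i)) // cardC1 card_ord prednK // (leq_trans _ (ltn_ord i)).
pose u (p : 'I_r * 'I_a) : 'I_k * 'I_m := (i, x p.1).
pose w (p : 'I_r * 'I_a) (j : J) : 'I_k * 'I_m := (val j, q p.2 (val j)).
(* The pair whose arc decides adjacency in [fwd], fixed in advance by [rho]; injectivity of [x] and
   of the coordinates of [q] makes these arcs distinct. *)
pose e p j : V * V := if rho (u p) < rho (w p j) then (em (u p), em (w p j)) else (em (w p j), em (u p)).
have et p j : tag (e p j).1 != tag (e p j).2.
  by rewrite /e; case: ifP => _ /=; [rewrite eq_sym|]; apply: (valP j).
have uw p p' j : (u p == w p' j) = false.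
  by case: j => j ji; apply/negP => /eqP[/= ij _]; rewrite ij eqxx in ji.
have ei p j p' j' : e p j = e p' j' \/ e p j = swap_pair (e p' j') -> p = p' /\ j = j'.
  move=> H; have {H}[] : u p = u p' /\ w p j = w p' j'.
    move: H; rewrite /e; do 2 case: ifP => _; rewrite /swap_pair /=;
    case=> /emb_pair[e1 e2] //; move: (uw p p' j') (uw p' p j);
    by rewrite ?e1 ?e2 -?e1 -?e2 eqxx.
  case: p p' => [v b] [v' b'] [/xI ->] [/val_inj jj]; rewrite jj => /qI ->.
  by split.
have := @few_bad_orientations k n 'I_r 'I_a J e d et ei.
rewrite !card_ord cJ => /(_ ad); congr (_ * _ <= _); apply: eq_card => A.
rewrite !inE; congr (_ && _); apply: eq_forallb => v; congr (_ < _).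
apply: eq_card => b; rewrite !inE; apply/forallP/completesP => [H j ji|H j].
  have := H (Sub j ji); rewrite /e /fwd /u /w /=.
  by case: ifP.
by have := H (val j) (valP j); rewrite /e /fwd /u /w /=; case: ifP.
Qed.

End Random.

(** * Good orientations and the final count *)

Section Good.
Variables (k : nat) (n : nat -> nat).
Notation V := (vtx k n).
Notation Or := (orientations k n).

Lemma spread_fwd m N (mn : forall i : 'I_k, m <= n i) d a r A
    (rho : {ffun 'I_k * 'I_m -> 'I_N}) :
  A \in Or -> A \notin \bigcup_p @not_spread_ev k n m N mn d a r p ->
  spread (fwd A mn rho) d a r.
Proof.
move=> AO An i q X qI rX.
pose x := [ffun v : 'I_r => enum_val (widen_ord rX v)].
have xI : injective x.
  by move=> v v'; rewrite !ffunE => /enum_val_inj /(congr1 val) /= /val_inj.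
have {}An : A \notin not_spread_ev mn d (rho, i, [ffun b => q b], x).
  by apply: contra An => An; apply/bigcupP; exists (rho, i, [ffun b => q b], x).
have : ~~ [forall v, #|[set b | completes (fwd A mn rho) i (x v) (q b)]| < d].
  apply: contra An => H; rewrite inE AO /=; apply/and3P; split.
  - exact/injectiveP.
  - by apply/forallP => j; apply/injectiveP => b b'; rewrite !ffunE => /qI.
  - apply/forallP => v; move/forallP/(_ v): H.
    apply: leq_ltn_trans; rewrite eq_leq //; apply: eq_card => b.
    by rewrite !inE; congr completes; rewrite ffunE.
rewrite negb_forall => /existsP[v]; rewrite -leqNgt => H.
by exists (x v); rewrite // ffunE; apply: enum_valP.
Qed.

(** The three exclusions supply the hypotheses of [tiling_exists]: degrees ([fwd_degree] halves
    [2 * d1]), cliques inside large sets, and enough exchanges for absorption. *)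
Lemma fk_is_of_good m N (mn : forall i : 'I_k, m <= n i) e d d1 a r A :
  1 < k -> m = n k.-1 -> k <= m -> N = #|{: 'I_k * 'I_m}|.+1 * #|{: 'I_k * 'I_m}| ->
  0 < e -> 2 * (k * r).+1 <= d -> k.-1 + k * a + k * r + (k * r).+1 <= d1 -> d1 <= m ->
  A \in Or ->
  A \notin \bigcup_p no_path_ev mn (2 * d1) p ->
  A \notin \bigcup_p @not_spread_ev k n m N mn e r r p ->
  A \notin \bigcup_p @not_spread_ev k n m N mn d a r p ->
  fk_is (fun u v => A (u, v)) k (n k.-1 - k + 1).
Proof.
move=> k1 mE km NE e0 dr d1r d1m AO A1 A2 A3; split; last first.
  by move=> t; apply: fk_prop_le; rewrite -?mE.
move=> F /(feedback_rank mn NE)[rho [rI rF]].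
have [|T [sT cT uT]] := tiling_exists (fwd_sym A mn rI) k1 e0
  (spread_fwd rho AO A2) (spread_fwd rho AO A3) _ dr d1r d1m.
  move=> i j x x' ij; apply: fwd_degree => // {}x {}x' xx.
  rewrite leqNgt; apply: contra A1 => H; apply/bigcupP; exists (i, j, x, x') => //.
  by rewrite inE AO ij xx.
by apply: (disjoint_TT_of_tiling rI rF _ cT uT); rewrite sT mE; lia.
Qed.

End Good.

(* Classes indexed 0..k-1; class k-1 plays the role of V_k (the smallest), so
   s(G) = n (k.-1).  "With probability 1 - o(1) as n_k -> oo" is read uniformly
   in n_1,...,n_{k-1}. *)
Theorem theorem1 (k : nat) (hk : (2 <= k)%N) (eps : rat) (heps : (0 < eps)%R) :
  exists N : nat, forall n : nat -> nat,
    (forall i, (i < k)%N -> (0 < n i)%N) ->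
    (forall i, (i < k)%N -> (n k.-1 <= n i)%N) ->
    (N <= n k.-1)%N ->
    (1 - eps <= @prob_T k n
       (fun A => fk_is (fun u v => A (u, v)) k (n k.-1 - k + 1)%N))%R.
Proof.
pose J := Num.bound (eps^-1)%R.
have JP : (eps^-1 < J%:R :> rat)%R by apply: archi_boundP; rewrite invr_ge0 ltW.
pose M := 2 ^ k.
have M0 : 0 < M by rewrite expn_gt0.
pose K := k + k * (4 * M * (2 * k * M + 1)) + 4 * k * M + 1.
have K0 : 0 < K by rewrite /K addn1.
(* Exponents of [Q] per unit of [e]: orders give [2 * (k * m)] with [m <= 64 * K * e], the class
   gives 1, tuples and vertices give at most [d1 <= K * e] each; the 4 serves the no-path event. *)
pose D := 2 * k * (64 * K) + 1 + K + K + 4.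
have [E0 HE] := poly_le_exp D (3 * J * (k * (64 * K) + 1) ^ D).
exists (32 * K * (E0 + 1) + k) => n _ nmin; set m := n k.-1 => Nn.
have mn (i : 'I_k) : m <= n i by apply: nmin.
have [e0 em mLe] := scale_division K m E0 K0 (leq_trans (leq_addr _ _) Nn).
have km : k <= m := leq_trans (leq_addl _ _) Nn.
set e := m %/ (32 * K) in e0 em mLe.
have e_gt0 : 0 < e := leq_ltn_trans (leq0n _) e0.
pose r := 2 * M * e.
pose d := 2 * (k * r).+1.
pose a := 2 * M * d.
pose d1 := k.-1 + k * a + k * r + (k * r).+1.
have d1K : d1 <= K * e := scale_budget k M e e_gt0.
have k_gt0 : 0 < k := ltnW hk.
have er : e <= r by rewrite /r leq_pmull // muln_gt0.
have rkr : r <= k * r by rewrite leq_pmull.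
have ed : e <= d by rewrite /d; move: er rkr; lia.
have ed1 : e <= d1 by rewrite /d1; move: er rkr; lia.
have d1m : 16 * (2 * d1) <= m by apply: leq_trans em; move: d1K; lia.
pose N := #|{: 'I_k * 'I_m}|.+1 * #|{: 'I_k * 'I_m}|.
pose Q := k * m + 1.
have Q0 : 0 < Q by rewrite /Q addn1.
have Qe : 3 * J * Q ^ D <= 2 ^ e.
  apply: leq_trans (HE e (ltnW e0)).
  rewrite -[leqRHS]mulnA -expnMn leq_mul2l; apply/orP; right.
  rewrite leq_exp2r; last by rewrite /D addn4.
  rewrite /Q mulnDl mul1n -mulnA leq_add ?leq_mul2l //.
  by rewrite mLe orbT.
have mQ : m <= Q by rewrite /Q addn1 ltnW // ltnS leq_pmull.
have kQ : k <= Q by rewrite (leq_trans km).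
have NQ : N <= Q ^ 2.
  rewrite /N card_prod !card_ord /Q addn1 expnS expn1 leq_mul2l.
  by rewrite ltnW ?orbT.
have powS x y z : x <= y -> x ^ z <= y ^ z by case: z => // z xy; rewrite leq_exp2r.
have params_le a' :
  N ^ (k * m) * k * ((m ^ k) ^ a') * m ^ r <= Q ^ (2 * (k * m) + 1 + k * a' + r).
  rewrite (expnD _ _ r) (expnD _ _ (k * a')) (expnD _ _ 1) expn1 -[(m ^ k) ^ a']expnM [Q ^ (2 * _)]expnM.
  by rewrite !leq_mul ?powS.
have share (x s : nat) T : T <= Q ^ x -> x <= D * e -> e <= s -> 3 * J * T <= 2 ^ (e * s).
  move=> TQ xD es; apply: leq_trans (power_budget (3 * J) Q D x e s Q0 e_gt0 xD es Qe).
  by rewrite leq_mul2l TQ orbT.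
pose bad1 := \bigcup_p no_path_ev mn (2 * d1) p.
pose bad2 := \bigcup_p @not_spread_ev k n m N mn e r r p.
pose bad3 := \bigcup_p @not_spread_ev k n m N mn d a r p.
have xD a' : k * a' <= d1 -> 2 * (k * m) + 1 + k * a' + r <= D * e.
  move=> ha; have : 2 * (k * m) <= 2 * k * (64 * K) * e.
    by rewrite -!mulnA leq_mul2l /= leq_mul2l mulnA mLe orbT.
  have : r <= d1 by rewrite /d1; move: rkr; lia.
  move: d1K; rewrite /D; lia.
(* There are at most [Q ^ 4] parameters here, so a failure probability exponentially small in [e] is
   enough. *)
have b1 : 3 * (#|bad1| * J) <= #|orientations k n|.
  apply: union_share (card_bigcup_le (fun p => card_no_path mn p d1m)) _.
    by rewrite expn_gt0.
  rewrite !card_prod !card_ord; apply: leq_trans (_ : 2 ^ e <= _); last first.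
    by rewrite leq_exp2l //; move: ed1; lia.
  apply: leq_trans Qe; rewrite leq_mul2l; apply/orP; right.
  apply: leq_trans (_ : Q ^ 4 <= _); last by rewrite leq_pexp2l // /D leq_addl.
  by rewrite !expnS expn0 muln1 -!mulnA !leq_mul.
(* The value [r = 2 * M * e] is the number of tuples that [card_not_spread] requires when its [d] is
   [e]. *)
have b2 : 3 * (#|bad2| * J) <= #|orientations k n|.
  apply: union_share (card_bigcup_le (fun p => card_not_spread mn p (erefl r))) _.
    by rewrite expn_gt0.
  rewrite !(card_prod, card_ffun, card_ord).
  apply: (share (2 * (k * m) + 1 + k * r + r)) => //.
  by apply: xD; rewrite /d1; move: (k * r) (k * a) => ? ?; lia.
have b3 : 3 * (#|bad3| * J) <= #|orientations k n|.
  apply: union_share (card_bigcup_le (fun p => card_not_spread mn p (erefl a))) _.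
    by rewrite expn_gt0.
  rewrite !(card_prod, card_ffun, card_ord).
  apply: leq_trans (_ : 2 ^ (e * r) <= _); last by rewrite leq_exp2l // leq_mul2r ed orbT.
  apply: (share (2 * (k * m) + 1 + k * a + r)) => //.
  by apply: xD; rewrite /d1; move: (k * r) (k * a) => ? ?; lia.
have O0 := orientations_gt0 k n.
pose bad := bad1 :|: bad2 :|: bad3.
rewrite /prob_T; apply: (@ratio_ge _ J _ #|bad|) => //.
  apply: leq_trans (leq_card_setU _ _); apply/subset_leq_card/subsetP => A AO.
  rewrite in_setU; case: (boolP (A \in bad)) => [_|]; rewrite ?orbT // orbF.
  rewrite !in_setU !negb_or => /andP[/andP[A1 A2] A3].
  rewrite in_set AO; apply/asboolP.
  have d1m' : d1 <= m by apply: leq_trans d1m; lia.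
  exact: (@fk_is_of_good k n m N mn e d d1 a r A hk erefl km erefl e_gt0 (leqnn _) (leqnn _)).
have cb : #|bad| <= #|bad1| + #|bad2| + #|bad3|.
  apply: leq_trans (leq_card_setU _ _) _; rewrite leq_add2r; exact: leq_card_setU.
have : #|bad| * J <= (#|bad1| + #|bad2| + #|bad3|) * J by rewrite leq_mul2r cb orbT.
rewrite !mulnDl; move: b1 b2 b3; move: (_ * J) (_ * J) (_ * J) (_ * J) => ? ? ? ?; lia.
Qed.
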